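(* Let $\mathcal F(u)=L_0(u)+\varepsilon\bar F(u)$ be the truncated $R_\theta$-equivariant vector field on $X=\mathbb C\times\mathbb S^1\times\mathbb R$, where $L_0(z,\psi,w)=(i\omega_0z,\Omega_0,0)$. (1) Let $u^*\in X$ be a relative equilibrium of $\dot u=\mathcal F(u)$ with nonzero $z$-component, and let $u^\Sigma=R_\theta(u^* )$ (for some $\theta\in\mathbb R$) be a representative of its orbit in the cross-section $\Sigma=\{(z,\psi,w)\in X:\Im z=0,\ \Re z>0\}$, written as $u^\Sigma=(x^*,\psi^*,w^* )$ with $x^*\in\mathbb R^+$. Then $u^*$ has the group velocity $$\xi=1+\frac{\varepsilon}{\Omega_0}\bar F_\psi(x^*,\psi^*,w^* )=1+\frac{\varepsilon}{\omega_0x^*}\Im\bigl(\bar F_z(x^*,\psi^*,w^* )\bigr),\qquad(\mathrm{a})$$ and the following conditions hold: $$\Re\bigl(\bar F_z(x^*,\psi^*,w^* )\bigr)=0,\qquad \bar F_w(x^*,\psi^*,w^* )=0,\qquad \frac{\Im\bigl(\bar F_z(x^*,\psi^*,w^* )\bigr)}{x^*}=\frac{\omega_0}{\Omega_0}\bar F_\psi(x^*,\psi^*,w^* ).\qquad(\mathrm{b})$$ (2) Conversely, let $u^\Sigma=(x^*,\psi^*,w^* )\in\Sigma$ with $x^*>0$ satisfy the three conditions (b). Then $u^\Sigma$ is a relative equilibrium of $\dot u=\mathcal F(u)$ with group velocity $\xi$ given by (a), and every point on its orbit $\mathcal O(u^\Sigma)=\{R_\theta(u^\Sigma):\theta\in\mathbb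 R\}$ is also a relative equilibrium; equivalently, any $u_0\in\mathcal O(u^\Sigma)$ satisfies $$\Phi_t^{\mathcal F}(u_0)=R_{\xi t}(u_0),\qquad t\in\mathbb R.$$
   Context: Here $\omega_0>0$, $\Omega_0\ne0$ are constants with $\omega_0/\Omega_0\in\mathbb Q$, and $0<\varepsilon\ll1$. Vector fields on $X$ ($\mathbb S^1=\mathbb R/2\pi\mathbb Z$) are written in components $(F_z,F_\psi,F_w)$, $F_z$ complex-valued and $F_\psi,F_w$ real-valued. $R_\theta(z,\psi,w)=(e^{i\omega_0\theta}z,\psi+\Omega_0\theta,w)$ for $\theta\in\mathbb R$; it is the flow of $L_0$, it is periodic in $\theta$ with some minimal period $T>0$, and so defines an action of the circle group $\mathbb R/T\mathbb Z$ on $X$. A vector field $G$ is $R_\theta$-equivariant if $DR_\theta(u)G(u)=G(R_\theta(u))$ for all $u\in X$, $\theta\in\mathbb R$. $\bar F$ is the resonant projection of a vector field $F$ with finite Fourier--Taylor expansion: $F_j=\sum_{\alpha\in\mathcal A}f_j^\alpha M_\alpha$ (finitely many nonzero coefficients), $\mathcal A=\mathbb N_0\times\mathbb N_0\times\mathbb Z\times\mathbb N_0$, $M_{(a,b,k,c)}=z^a\bar z^be^{ik\psi}w^c$, and $\bar F_j$ is the sum over only those $\alpha=(a,b,k,c)$ with $\lambda_\alpha^{(j)}=0$, where $\lambda^{(z)}_\alpha=(a-b-1)\omega_0+k\Omega_0$ and $\lambda_\alpha^{(\psi)}=\lambda_\alpha^{(w)}=(a-b)\omega_0+k\Omega_0$.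 With this choice $\mathcal F=L_0+\varepsilon\bar F$ is $R_\theta$-equivariant. $\Phi_t^{\mathcal F}$ denotes the flow of $\dot u=\mathcal F(u)$. A point $u^*$ (or its solution) is a relative equilibrium with group velocity $\xi\in\mathbb R$ if $\Phi_t^{\mathcal F}(u^* )=R_{\xi t}(u^* )$ for all $t\in\mathbb R$. *)

(* Defs.v *)
From HB Require Import structures.
From mathcomp Require Import all_boot all_order all_algebra generic_quotient
  ring_quotient finmap.
From mathcomp Require Import all_classical all_reals all_analysis.
From mathcomp Require Import complex ring.

Set Implicit Arguments.
Unset Strict Implicit.
Unset Printing Implicit Defensive.

Import Order.TTheory GRing.Theory Num.Theory.
Import numFieldNormedType.Exports.
Local Open Scope classical_set_scope.
Local Open Scope ring_scope.
Local Open Scope quotient_scope.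
Local Open Scope complex_scope.

Definition two_pi_int (R : realType) : {pred R} :=
  [pred x : R | x / (2 * pi) \is a Num.int].

Lemma two_pi_int_closed (R : realType) : zmod_closed (@two_pi_int R).
Proof.
split=> [|x y]; rewrite !inE ?mul0r ?rpred0 // => xZ yZ.
by rewrite mulrBl rpredB.
Qed.

HB.instance Definition _ (R : realType) :=
  GRing.isZmodClosed.Build R (@two_pi_int R) (@two_pi_int_closed R).

Definition circle (R : realType) : zmodType := {ideal_quot (@two_pi_int R)}.

Definition to_circle (R : realType) (x : R) : circle R :=
  \pi_({ideal_quot (@two_pi_int R)}) x.

Definition circle_repr (R : realType) (psi : circle R) : R :=
  repr (psi : {ideal_quot (@two_pi_int R)}).

Definition phase (R : realType) : Type := (R[i] * circle R * R)%type.
Definition tangent (R : realType) : Type := (R[i] * R * R)%type.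

Definition expi (R : realType) (x : R) : R[i] := cos x +i* sin x.

Definition rotate (R : realType) (om Om theta : R) (u : phase R) : phase R :=
  let: (z, psi, w) := u in
  (expi (om * theta) * z, psi + to_circle (Om * theta), w).

Definition L0 (R : realType) (om Om : R) (u : phase R) : tangent R :=
  let: (z, psi, w) := u in (om *i * z, Om, 0).

Definition orbit_of (R : realType) (om Om : R) (u : phase R) :
    set (phase R) :=
  [set rotate om Om theta u | theta in setT].

Definition cross_section (R : realType) : set (phase R) :=
  [set u : phase R | complex.Im u.1.1 = 0 /\ 0 < complex.Re u.1.1].

(* (a, b, k, c) stands for z^a * conj(z)^b * e^(i k psi) * w^c. *)

Definition mindex : Type := (nat * nat * int * nat)%type.

(* The value does not depend on the representative, see [harmonic_to_circle]. *)
Definition harmonic (R : realType) (k : int) (psi : circle R) : R[i] :=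
  expi (k%:~R * circle_repr psi).

Definition monom (R : realType) (al : mindex) (u : phase R) : R[i] :=
  let: (a, b, k, c) := al in let: (z, psi, w) := u in
  z ^+ a * (conjc z) ^+ b * harmonic k psi * (w%:C) ^+ c.

Definition ft_coef (R : realType) : Type := {fsfun mindex -> R[i] with 0}.

Definition ft_sum (R : realType) (P : pred mindex) (f : ft_coef R)
    (u : phase R) : R[i] :=
  \sum_(al <- finsupp f | P al) f al * monom al u.

Record ft_coefs (R : realType) : Type := FtCoefs {
  coef_z : ft_coef R; coef_psi : ft_coef R; coef_w : ft_coef R }.

Definition ft_expansion (R : realType) (F : phase R -> tangent R)
    (f : ft_coefs R) : Prop :=
  forall u : phase R,
    [/\ (F u).1.1 = ft_sum predT (coef_z f) u,
        ((F u).1.2)%:C = ft_sum predT (coef_psi f) u &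
        ((F u).2)%:C = ft_sum predT (coef_w f) u].

Definition lambda_z (R : realType) (om Om : R) (al : mindex) : R :=
  let: (a, b, k, c) := al in (a%:R - b%:R - 1) * om + k%:~R * Om.

Definition lambda_r (R : realType) (om Om : R) (al : mindex) : R :=
  let: (a, b, k, c) := al in (a%:R - b%:R) * om + k%:~R * Om.

(* Taking real parts discards nothing: when f is the expansion of a vector
   field the last two sums are real, see [resonant_field_psi] and
   [resonant_field_w]. *)
Definition resonant_field (R : realType) (om Om : R) (f : ft_coefs R)
    (u : phase R) : tangent R :=
  (ft_sum (fun al => lambda_z om Om al == 0) (coef_z f) u,
   complex.Re (ft_sum (fun al => lambda_r om Om al == 0) (coef_psi f) u),
   complex.Re (ft_sum (fun al => lambda_r om Om al == 0) (coef_w f) u)).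

Definition truncated_field (R : realType) (om Om eps : R) (f : ft_coefs R)
    (u : phase R) : tangent R :=
  let: (lz, lpsi, lw) := L0 om Om u in
  let: (fz, fpsi, fw) := resonant_field om Om f u in
  (lz + eps%:C * fz, lpsi + eps * fpsi, lw + eps * fw).

(* Velocity at time t of a curve in X; the velocity in S^1 is read off from a
   real-valued local lift. *)
Definition has_velocity (R : realType) (g : R -> phase R) (t : R)
    (v : tangent R) : Prop :=
  [/\ is_derive t 1 (fun s => complex.Re (g s).1.1 : R) (complex.Re v.1.1),
      is_derive t 1 (fun s => complex.Im (g s).1.1 : R) (complex.Im v.1.1),
      exists2 l : R -> R,
        \forall s \near t, (g s).1.2 = to_circle (l s) & is_derive t 1 l v.1.2 &
      is_derive t 1 (fun s => (g s).2 : R) v.2].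

Definition flows_to (R : realType) (F : phase R -> tangent R) (t : R)
    (u v : phase R) : Prop :=
  exists (I : set R) (g : R -> phase R),
    [/\ open I, is_interval I, I 0 & I t] /\
    [/\ g 0 = u, g t = v & forall s, I s -> has_velocity g s (F (g s))].

(* The flow is partial: [None] when no solution from u lives up to time t.
   For the locally Lipschitz fields considered here the chosen point is the
   only one. *)
Definition flow (R : realType) (F : phase R -> tangent R) (t : R)
    (u : phase R) : option (phase R) :=
  if pselect (exists v, flows_to F t u v) is left ex
  then Some (projT1 (cid ex)) else None.

(* [om] and [Om] are the frequencies omega_0 and Omega_0; [xi] is the group
   velocity. *)
Definition relative_equilibrium (R : realType) (om Om : R)
    (F : phase R -> tangent R) (u : phase R) (xi : R) : Prop :=
  forall t : R, flow F t u = Some (rotate om Om (xi * t) u).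

Lemma expiD (R : realType) (x y : R) : expi (x + y) = expi x * expi y.
Proof.
apply/eqP; rewrite eq_complex /= cosD sinD eqxx /=.
by rewrite addrC [cos x * sin y + _]addrC eqxx.
Qed.

Lemma expiN (R : realType) (x : R) : expi (- x) = (expi x)^*.
Proof. by rewrite /expi cosN sinN. Qed.

Lemma expi0 (R : realType) : expi (0 : R) = 1.
Proof. by rewrite /expi cos0 sin0. Qed.

Lemma expi_natmul (R : realType) (n : nat) (x : R) :
  expi (n%:R * x) = expi x ^+ n.
Proof.
elim: n => [|n IHn]; first by rewrite mul0r expi0 expr0.
by rewrite -natr1 mulrDl mul1r expiD IHn exprSr.
Qed.

Lemma expi_two_pi (R : realType) (m : int) : expi (m%:~R * (2 * pi)) = 1 :> R[i].
Proof.
have e1 : expi (2 * pi : R) = 1.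
  by rewrite mulr_natl mulr2n expiD /expi cospi sinpi; apply/eqP;
    rewrite eq_complex /= !(mulr0, mul0r) mulrNN mulr1 subr0 addr0 !eqxx.
case: m => n; first by rewrite -pmulrn expi_natmul e1 expr1n.
by rewrite NegzE mulrNz mulNr expiN -pmulrn expi_natmul e1 expr1n conjc1.
Qed.

Lemma expi_circle (R : realType) (k : int) (x y : R) :
  to_circle x = to_circle y -> expi (k%:~R * x) = expi (k%:~R * y).
Proof.
move/eqP; rewrite /to_circle -Quotient.idealrBE inE => /intrP[m xy].
have pi2 : 2 * pi != 0 :> R by rewrite mulf_neq0 ?pnatr_eq0 ?gt_eqF ?pi_gt0.
have -> : x = y + m%:~R * (2 * pi) by rewrite -xy divfK // addrC subrK.
by rewrite mulrDr mulrA -intrM expiD expi_two_pi mulr1.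
Qed.

Lemma harmonic_to_circle (R : realType) (k : int) (x : R) :
  harmonic k (to_circle x) = expi (k%:~R * x).
Proof. by apply: expi_circle; exact: reprK. Qed.

Lemma monom_rotate (R : realType) (om Om theta : R) (al : mindex)
    (u : phase R) :
  monom al (rotate om Om theta u) = expi (lambda_r om Om al * theta) * monom al u.
Proof.
case: al => [[[a b] k] c]; case: u => [[z psi] w] /=.
have -> : psi + to_circle (Om * theta) = to_circle (circle_repr psi + Om * theta).
  rewrite /to_circle [RHS]raddfD /=; congr (_ + _).
  by rewrite /circle_repr reprK.
have conjcM (x y : R[i]) : conjc (x * y) = conjc x * conjc y by exact: rmorphM.
rewrite harmonic_to_circle /harmonic mulrDr expiD !exprMn. rewrite conjcM exprMn -expiN.
rewrite -!expi_natmul.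
have -> : ((a%:R - b%:R) * om + k%:~R * Om) * theta =
  a%:R * (om * theta) + b%:R * (- (om * theta)) + k%:~R * (Om * theta) by ring.
by rewrite !expiD; ring.
Qed.

Lemma Im_constant_term (R : realType) (s : seq (R[i] * R)) (K : R[i]) :
  all (fun p => p.2 != 0) s ->
  (forall theta, complex.Im (K + \sum_(p <- s) p.1 * expi (p.2 * theta)) = 0) ->
  complex.Im K = 0.
Proof.
elim: {s}(size s) {-2}s (eqxx (size s)) K => [|n IHn] [|[c l] s] //= sn K.
  by move=> _ /(_ 0); rewrite big_nil addr0.
case/andP=> l0 s0 KE.
pose h := pi / l.
pose s' := [seq (p.1 * (1 + expi (p.2 * h)), p.2) | p <- s].
suff : complex.Im (K + K) = 0.
  by rewrite raddfD /= -mulr2n => /eqP; rewrite mulrn_eq0 => /eqP.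
apply: (IHn s'); rewrite ?size_map //; first by rewrite all_map.
move=> theta; have := congr2 +%R (KE (theta + h)) (KE theta).
rewrite addr0 -raddfD => <-.
congr (complex.Im _); rewrite !big_cons big_map /=.
have -> : expi (l * (theta + h)) = - expi (l * theta).
  rewrite mulrDr expiD [l * h]mulrC divfK // {2}/expi cospi sinpi.
  by apply/eqP; rewrite eq_complex /= !(mulr0, mulrN1) subr0 add0r !eqxx.
under eq_bigr => p _ do rewrite -mulrA mulrDl mul1r -expiD -mulrDr [h + _]addrC mulrDr.
rewrite big_split /=; ring.
Qed.

Lemma resonant_sum_real (R : realType) (om Om : R) (f : ft_coef R) :
  (forall u, complex.Im (ft_sum predT f u) = 0) ->
  forall u, complex.Im (ft_sum (fun al => lambda_r om Om al == 0) f u) = 0.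
Proof.
move=> fr u.
pose s := [seq (f al * monom al u, lambda_r om Om al) |
  al <- finsupp f & lambda_r om Om al != 0].
apply: (@Im_constant_term _ s).
  by rewrite all_map; apply/allP => al; rewrite mem_filter => /andP[].
move=> theta; rewrite -[RHS](fr (rotate om Om theta u)) /ft_sum.
rewrite [in RHS](bigID (fun al => lambda_r om Om al == 0)) /= big_map big_filter.
congr (complex.Im (_ + _)); apply: eq_bigr => al.
  by move=> /eqP al0; rewrite monom_rotate al0 mul0r expi0 mul1r.
by rewrite monom_rotate /= mulrAC mulrA.
Qed.

Lemma resonant_field_psi (R : realType) (om Om : R) (F : phase R -> tangent R)
    (f : ft_coefs R) (u : phase R) :
  ft_expansion F f ->
  (resonant_field om Om f u).1.2%:C =
  ft_sum (fun al => lambda_r om Om al == 0) (coef_psi f) u.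
Proof.
move=> Ff /=; apply/eqP; rewrite eq_complex /= eqxx eq_sym.
by apply/eqP/resonant_sum_real => v; case: (Ff v) => _ <-.
Qed.

Lemma resonant_field_w (R : realType) (om Om : R) (F : phase R -> tangent R)
    (f : ft_coefs R) (u : phase R) :
  ft_expansion F f ->
  (resonant_field om Om f u).2%:C =
  ft_sum (fun al => lambda_r om Om al == 0) (coef_w f) u.
Proof.
move=> Ff /=; apply/eqP; rewrite eq_complex /= eqxx eq_sym.
by apply/eqP/resonant_sum_real => v; case: (Ff v) => _ _ <-.
Qed.

Lemma truncated_field_equivariant (R : realType) (om Om eps theta : R)
    (f : ft_coefs R) (u : phase R) :
  truncated_field om Om eps f (rotate om Om theta u) =
  let: (vz, vpsi, vw) := truncated_field om Om eps f u in
  (expi (om * theta) * vz, vpsi, vw).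
Proof.
have inv g : ft_sum (fun al => lambda_r om Om al == 0) g (rotate om Om theta u) =
    ft_sum (fun al => lambda_r om Om al == 0) g u.
  apply: eq_bigr => al /eqP al0.
  by rewrite monom_rotate al0 mul0r expi0 mul1r.
have equi g : ft_sum (fun al => lambda_z om Om al == 0) g (rotate om Om theta u) =
    expi (om * theta) * ft_sum (fun al => lambda_z om Om al == 0) g u.
  rewrite mulr_sumr; apply: eq_bigr => al /eqP al0.
  have lamE : lambda_r om Om al = lambda_z om Om al + om.
    by case: al {al0} => [[[a b] k] c] /=; ring.
  by rewrite monom_rotate lamE al0 add0r mulrCA.
rewrite /truncated_field /resonant_field !inv equi.
case: u {inv equi} => [[z psi] w] /=; congr (_, _, _).
by rewrite mulrDr mulrCA [eps%:C * _]mulrCA.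
Qed.

(* Main.v *)
(* A point [u] is a relative equilibrium with group velocity [xi] exactly when
   the truncated field at [u] is [xi] times the infinitesimal rotation; on the
   cross-section this pointwise equation unfolds to (a) and (b).

   If the pointwise equation holds at [u], equivariance propagates it along the
   group orbit, so [t |-> R_(xi t) u] is a solution, and it is the flow by
   uniqueness of solutions.  Conversely, a relative equilibrium provides one
   solution up to time 1, which by uniqueness follows the orbit at all
   intermediate times; comparing velocities at time 1/2 and rotating back gives
   the equation at [u].

   Uniqueness is proved with the squared distance of two solutions, measured in
   the coordinates [(Re z, Im z, cos psi, sin psi, w)], in which the field is
   polynomial: by a Gronwall argument its zero set is open, and it is closed by
   continuity, hence is the whole time interval. *)

Require Import Defs.
From mathcomp Require Import all_boot all_order all_algebra.
From mathcomp Require Import all_classical all_reals all_analysis.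
From mathcomp Require Import complex ring lra.
Import Order.TTheory GRing.Theory Num.Theory.
Import numFieldNormedType.Exports.
Local Open Scope classical_set_scope.
Local Open Scope ring_scope.
Local Open Scope complex_scope.
Set Implicit Arguments.
Unset Strict Implicit.
Unset Printing Implicit Defensive.

(** * A two-sided Gronwall argument *)

(** Damped by an exponential integrating factor, [D] cannot increase as the argument moves away from
    [s0]. It starts at 0 and is nonnegative, so it stays 0. The absolute value on [dD] serves both
    directions of time. *)
Lemma gronwall_eq0 (R : realType) (K s0 : R) (D dD : R -> R) :
  D s0 = 0 ->
  (\forall s \near s0, 0 <= D s) ->
  (\forall s \near s0, is_derive s (1 : R) D (dD s)) ->
  (\forall s \near s0, `|dD s| <= K * D s) ->
  \forall s \near s0, D s = 0.
Proof.
move=> D0 Dge0 derD leD.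
have /nbhs_ballP[r /= r0 Hr] :
    \forall s \near s0, [/\ 0 <= D s, is_derive s (1 : R) D (dD s) & `|dD s| <= K * D s].
  by near=> s; split; near: s.
apply/nbhs_ballP; exists r => //= s sr.
pose h := s - s0.
have Hseg (x : R) : x \in `[0, 1]%R -> ball s0 r (s0 + x * h).
  rewrite in_itv /= => /andP[x0 x1]; rewrite /ball /= opprD addrA subrr sub0r normrN.
  rewrite normrM ger0_norm //; apply: le_lt_trans (_ : `|h| < r).
    by rewrite ler_piMl.
  by rewrite /h distrC.
(* Running along the segment from [s0] to [s] treats both sides of [s0] at once. *)
pose g x := D (s0 + x * h) * expR (- (K * `|h|) * x).
pose dg x := (dD (s0 + x * h) * h - K * `|h| * D (s0 + x * h)) * expR (- (K * `|h|) * x).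
have derg (x : R) : x \in `[0, 1]%R -> is_derive x (1 : R) g (dg x).
  move=> /Hseg/Hr[_ dDx _].
  have d1 : is_derive x (1 : R) (fun x : R => s0 + x * h) h.
    apply: is_derive_eq; rewrite /GRing.scale /=; ring.
  have d2 : is_derive x (1 : R) (fun x : R => - (K * `|h|) * x) (- (K * `|h|)).
    apply: is_derive_eq; rewrite /GRing.scale /=; ring.
  have d3 := @is_derive1_comp _ D (fun x : R => s0 + x * h) x _ _ dDx d1.
  have d4 := @is_derive1_comp _ expR (fun x : R => - (K * `|h|) * x) x _ _ (is_derive_expR _) d2.
  have d5 : is_derive x (1 : R) g _ := is_deriveM d3 d4.
  by apply: is_derive_eq d5 _; rewrite /dg /= /GRing.scale /=; ring.
have dg_le0 (x : R) : x \in `[0, 1]%R -> dg x <= 0.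
  move=> /Hseg/Hr[Dx _ dDx]; rewrite /dg pmulr_lle0 ?expR_gt0 // subr_le0.
  apply: le_trans (ler_norm _) _; rewrite normrM mulrAC.
  by rewrite ler_wpM2r.
have sub (x : R) : x \in `]0, 1[%R -> x \in `[0 : R, 1]%R by exact: subset_itv_oo_cc.
have : g 1 <= g 0.
  apply: (@ler0_derive1_le_cc _ g 0 1) => [x /sub/derg[]//|x xin||||].
  - by have [_ gx] := derg x (sub x xin); rewrite derive1E gx dg_le0 // sub.
  - by apply: derivable_within_continuous => x /derg[].
  - by rewrite in_itv /= lexx ler01.
  - by rewrite in_itv /= lexx ler01.
  - exact: ler01.
rewrite /g mul0r addr0 D0 mul0r mul1r pmulr_lle0 ?expR_gt0 // {1}/h addrC subrK => le0.
by apply/eqP; rewrite eq_le le0; have [] := Hr s sr.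
Unshelve. all: by end_near. Qed.

(** * Local Lipschitz estimates along two curves, closed under polynomial operations *)

Section lipschitz_pairs.
Variables (R : realType) (s0 : R) (d : R -> R).

(* [a] and [b] are the values of one observable along two curves at distance
   [d]; this is local Lipschitz continuity of the observable seen on the curves. *)
Definition lip_pair (a b : R -> R) : Prop :=
  [/\ {for s0, continuous a}, {for s0, continuous b} &
      exists C, \forall s \near s0, `|a s - b s| <= C * d s].

Definition clip_pair (a b : R -> R[i]) : Prop :=
  lip_pair (fun s => complex.Re (a s)) (fun s => complex.Re (b s)) /\
  lip_pair (fun s => complex.Im (a s)) (fun s => complex.Im (b s)).

Lemma lip_cst c : lip_pair (fun=> c) (fun=> c).
Proof.
split; [exact: cst_continuous | exact: cst_continuous | exists 0].
by near=> s; rewrite subrr normr0 mul0r.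
Unshelve. all: by end_near. Qed.

Lemma lipD a b a' b' : lip_pair a b -> lip_pair a' b' ->
  lip_pair (fun s => a s + a' s) (fun s => b s + b' s).
Proof.
move=> [ca cb [C Cab]] [ca' cb' [C' Cab']].
split; [exact: (@continuousD _ _ _ a a') | exact: (@continuousD _ _ _ b b') |].
exists (C + C'); near=> s; rewrite opprD addrACA mulrDl.
by apply: le_trans (ler_normD _ _) _; apply: lerD; near: s.
Unshelve. all: by end_near. Qed.

Lemma lipN a b : lip_pair a b -> lip_pair (fun s => - a s) (fun s => - b s).
Proof.
move=> [ca cb [C Cab]].
split; [exact: (@continuousN _ _ _ a) | exact: (@continuousN _ _ _ b) |].
by exists C; near=> s; rewrite -opprD normrN; near: s.
Unshelve. all: by end_near. Qed.

Lemma continuous_norm_bounded (a : R -> R) : {for s0, continuous a} ->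
  \forall s \near s0, `|a s| <= `|a s0| + 1.
Proof. move=> ca; by apply: (@cvgr_norm_le _ _ _ _ _ a (a s0) ca); rewrite ltrDl. Qed.

(** This is where the continuity clauses of [lip_pair] enter: they bound [a] and [b'] near [s0] by
    their values at [s0] plus 1, and these bounds weight the constants of the other factors. *)
Lemma lipM a b a' b' : lip_pair a b -> lip_pair a' b' ->
  lip_pair (fun s => a s * a' s) (fun s => b s * b' s).
Proof.
move=> [ca cb [C Cab]] [ca' cb' [C' Cab']].
split; [exact: (@continuousM _ _ a a') | exact: (@continuousM _ _ b b') |].
exists ((`|a s0| + 1) * C' + (`|b' s0| + 1) * C); near=> s.
have -> : a s * a' s - b s * b' s = a s * (a' s - b' s) + b' s * (a s - b s) by ring.
rewrite mulrDl -!mulrA; apply: le_trans (ler_normD _ _) _; rewrite !normrM.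
apply: lerD; apply: ler_pM => //; near: s => //; exact: continuous_norm_bounded.
Unshelve. all: by end_near. Qed.

Lemma clip_cst c : clip_pair (fun=> c) (fun=> c).
Proof. by split; exact: lip_cst. Qed.

Lemma clipD a b a' b' : clip_pair a b -> clip_pair a' b' ->
  clip_pair (fun s => a s + a' s) (fun s => b s + b' s).
Proof.
move=> [ra ia] [ra' ia']; split.
  by have := lipD ra ra'; congr lip_pair; apply/funext => s; rewrite raddfD.
by have := lipD ia ia'; congr lip_pair; apply/funext => s; rewrite raddfD.
Qed.

Lemma clipM a b a' b' : clip_pair a b -> clip_pair a' b' ->
  clip_pair (fun s => a s * a' s) (fun s => b s * b' s).
Proof.
move=> [ra ia] [ra' ia']; split.
  have := lipD (lipM ra ra') (lipN (lipM ia ia')).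
  by congr lip_pair; apply/funext => s; case: (a s) (a' s) (b s) (b' s) =>
    [? ?] [? ?] [? ?] [? ?].
have := lipD (lipM ra ia') (lipM ia ra').
by congr lip_pair; apply/funext => s; case: (a s) (a' s) (b s) (b' s) =>
    [? ?] [? ?] [? ?] [? ?].
Qed.

Lemma clipX a b n : clip_pair a b ->
  clip_pair (fun s => a s ^+ n) (fun s => b s ^+ n).
Proof.
move=> ab; elim: n => [|n IHn]; first exact: clip_cst.
by have := clipM ab IHn; congr clip_pair; apply/funext => s; rewrite exprS.
Qed.

Lemma clip_conj a b : clip_pair a b ->
  clip_pair (fun s => conjc (a s)) (fun s => conjc (b s)).
Proof.
move=> [rab iab]; split.
  by move: rab; congr lip_pair; apply/funext => s; [case: (a s)|case: (b s)].
by have := lipN iab; congr lip_pair; apply/funext => s; [case: (a s)|case: (b s)].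
Qed.

Lemma clip_real a b : lip_pair a b ->
  clip_pair (fun s => (a s)%:C) (fun s => (b s)%:C).
Proof. by move=> ab; split=> //; exact: lip_cst. Qed.

Lemma clip_sum (T : Type) (r : seq T) (P : pred T) (a b : T -> R -> R[i]) :
  (forall i, P i -> clip_pair (a i) (b i)) ->
  clip_pair (fun s => \sum_(i <- r | P i) a i s) (fun s => \sum_(i <- r | P i) b i s).
Proof.
move=> ab; elim: r => [|i r IHr].
  by have := clip_cst 0; congr clip_pair; apply/funext => s; rewrite big_nil.
have [Pi|nPi] := boolP (P i).
  have := clipD (ab i Pi) IHr.
  by congr clip_pair; apply/funext => s; rewrite big_cons Pi.
by move: IHr; congr clip_pair; apply/funext => s; rewrite big_cons (negbTE nPi).
Qed.

End lipschitz_pairs.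

(** * Local uniqueness for curves in Euclidean space *)

(** The derivative of [D] is the sum of the terms [2 (x i - y i) (dx i - dy i)]. The difference of
    positions is at most the square root of [D], and that of velocities at most a constant times it,
    so the derivative is bounded by a multiple of [D] and [gronwall_eq0] applies. *)
Lemma local_uniqueness (R : realType) n (x y dx dy : 'I_n -> R -> R) (s0 : R) :
  let D s := \sum_(i < n) (x i s - y i s) ^+ 2 in
  D s0 = 0 ->
  (forall i, \forall s \near s0, is_derive s (1 : R) (x i) (dx i s)) ->
  (forall i, \forall s \near s0, is_derive s (1 : R) (y i) (dy i s)) ->
  (forall i, lip_pair s0 (fun s => Num.sqrt (D s)) (dx i) (dy i)) ->
  \forall s \near s0, D s = 0.
Proof.
move=> D D0 derx dery lip.
have Dge0 s : 0 <= D s by apply: sumr_ge0 => i _; exact: sqr_ge0.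
pose dd i s := 2 * (x i s - y i s) * (dx i s - dy i s).
pose dD := \sum_(i < n) dd i.
have [K leK] : exists K, \forall s \near s0, `|dD s| <= K * D s.
  (* The bound is built summand by summand, adding up the constants of the single coordinates. *)
  rewrite /dD; elim/big_ind: _ => [|h k [K hK] [L kL]|i _].
  - by exists 0; near=> s; rewrite normr0 mul0r.
  - exists (K + L); near=> s; rewrite mulrDl.
    by apply: le_trans (ler_normD _ _) _; apply: lerD; near: s.
  have [_ _ [C Ci]] := lip i.
  exists (2 * C); near=> s.
  have xy : `|x i s - y i s| <= Num.sqrt (D s).
    rewrite -sqrtr_sqr ler_wsqrtr // /D (bigD1 i) //= lerDl.
    by apply: sumr_ge0 => j _; exact: sqr_ge0.
  have le_d : `|dx i s - dy i s| <= C * Num.sqrt (D s) by near: s.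
  rewrite /dd !normrM ger0_norm // -!mulrA ler_pM2l //.
  rewrite -(sqr_sqrtr (Dge0 s)) expr2 mulrCA.
  exact: ler_pM.
apply: (gronwall_eq0 (dD := dD)) leK => //; first by near=> s.
have derxy i : \forall s \near s0,
    is_derive s (1 : R) (x i) (dx i s) /\ is_derive s (1 : R) (y i) (dy i s).
  by near=> s; split; near: s; [exact: derx|exact: dery].
(* The index type is finite, so one neighbourhood serves all coordinates. *)
have {}derxy := filter_forall _ derxy.
near=> s.
have -> : dD s = \sum_(i < n) dd i s by rewrite /dD fct_sumE.
have -> : D = \sum_(i < n) (x i - y i) ^+ 2 by rewrite fct_sumE.
apply: is_derive_sum => i.
have [dxi dyi] : is_derive s (1 : R) (x i) (dx i s) /\ is_derive s (1 : R) (y i) (dy i s).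
  by move: i; near: s; exact: derxy.
by apply: is_derive_eq; rewrite /dd /GRing.scale /= expr1.
Unshelve. all: by end_near. Qed.

(** * Points of the circle as unit complex numbers *)

(** Removing whole turns from [x - y] leaves a remainder [r] in [[0, 2 pi)] with cosine 1, which
    forces [r = 0]. *)
Lemma expi_inj_circle (R : realType) (x y : R) :
  expi x = expi y -> to_circle x = to_circle y.
Proof.
move=> xy; have pi2 : 0 < 2 * pi :> R by rewrite mulr_gt0 // pi_gt0.
have e1 : expi (x - y) = 1.
  by rewrite expiD expiN xy -expiN -expiD subrr expi0.
pose m := Num.floor ((x - y) / (2 * pi)).
pose r := x - y - m%:~R * (2 * pi).
have cr : cos r = 1.
  have : expi r = 1.
    by rewrite /r expiD e1 mul1r expiN expi_two_pi conjc1.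
  by move/(congr1 (@complex.Re R)).
have /andP[r0 r2] : 0 <= r < 2 * pi.
  have /andP[] := floor_itv ((x - y) / (2 * pi)).
  rewrite -/m ler_pdivlMr // ltr_pdivrMr // intrD [(m%:~R + _) * _]mulrDl mul1r => le_m lt_m.
  by rewrite /r subr_ge0 le_m ltrBlDl.
have r_eq0 : r = 0.
  have pi0 := pi_gt0 R.
  case: (leP r pi) => rpi.
    by apply: (@cos_inj R); rewrite ?in_itv /= ?cos0 ?lexx ?r0 ?rpi ?ltW.
  (* Cosine is injective only on [[0, pi]], so a remainder beyond [pi] is reflected into that
     interval; the value 0 obtained there contradicts [r < 2 * pi]. *)
  suff : 2 * pi - r = 0 by lra.
  apply: (@cos_inj R); rewrite ?in_itv /= ?lexx /=; [lra|lra|].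
  rewrite cos0 addrC cosD mulr_natl cos2pi sin2pi cosN cr; ring.
apply/eqP; rewrite /to_circle -Quotient.idealrBE inE.
apply/intrP; exists m; apply: (mulIf (lt0r_neq0 pi2)); rewrite divfK ?gt_eqF //.
by apply/eqP; rewrite -subr_eq0; apply/eqP.
Qed.

Lemma circle_reprK (R : realType) (psi : circle R) : to_circle (circle_repr psi) = psi.
Proof. exact: reprK. Qed.

Lemma to_circleD (R : realType) (x y : R) :
  to_circle (x + y) = to_circle x + to_circle y.
Proof. by rewrite /to_circle [LHS]raddfD. Qed.

Lemma harmonic1_inj (R : realType) : injective (@Defs.harmonic R 1).
Proof.
by move=> p q; rewrite /Defs.harmonic !mul1r => /expi_inj_circle; rewrite !circle_reprK.
Qed.

(** * Embedding of the phase space in five real coordinates, and uniqueness of solutions *)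

Section coordinates.
Variable R : realType.

(* The angle enters through [e^(i psi)] because a lift provided by
   [has_velocity] depends on the time and is differentiable at that time only. *)
Definition coord (u : phase R) (i : 'I_5) : R :=
  nth 0 [:: complex.Re u.1.1; complex.Im u.1.1; complex.Re (Defs.harmonic 1 u.1.2);
            complex.Im (Defs.harmonic 1 u.1.2); u.2] i.

(** The differential of [coord] at [u] applied to [v]; the angular entries come from differentiating
    [e^(i psi)]. *)
Definition dcoord (u : phase R) (v : tangent R) (i : 'I_5) : R :=
  nth 0 [:: complex.Re v.1.1; complex.Im v.1.1;
            - v.1.2 * complex.Im (Defs.harmonic 1 u.1.2);
            v.1.2 * complex.Re (Defs.harmonic 1 u.1.2); v.2] i.

Lemma coord_inj u u' : coord u =1 coord u' -> u = u'.
Proof.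
case: u u' => [[[x y] p] w] [[[x' y'] p'] w'] E.
have := E (inord 0); have := E (inord 1); have := E (inord 2).
have := E (inord 3); have := E (inord 4).
rewrite /coord !inordK //= => -> ei er -> ->; congr (_, _, _).
by apply: harmonic1_inj; apply/eqP; rewrite eq_complex /= er ei !eqxx.
Qed.

(** The embedding is an immersion: the angular speed is recovered by pairing the two angular entries
    with [- sin] and [cos], since the squares of sine and cosine sum to 1. *)
Lemma dcoord_inj u v v' : dcoord u v =1 dcoord u v' -> v = v'.
Proof.
case: v v' => [[[x y] p] w] [[[x' y'] p'] w'] E.
have := E (inord 0); have := E (inord 1); have := E (inord 2).
have := E (inord 3); have := E (inord 4).
rewrite /dcoord !inordK //= => -> ei er -> ->; congr (_, _, _).
have := cos2Dsin2 (1 * circle_repr u.1.2); move: er ei; rewrite /Defs.harmonic /= mul1r.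
move: (cos _) (sin _) => c s es ec cs.
suff : (p - p') * (c ^+ 2 + s ^+ 2) = 0.
  by rewrite cs mulr1 => /eqP; rewrite subr_eq0 => /eqP.
transitivity ((p * c - p' * c) * c - (- p * s - - p' * s) * s); first by ring.
by rewrite ec es; ring.
Qed.

(** Near [t] the first harmonic of the angle equals [e^(i l)] for the local lift [l], so the chain
    rule gives the two angular coordinates. *)
Lemma has_velocity_coord (g : R -> phase R) (t : R) (v : tangent R) (i : 'I_5) :
  has_velocity g t v ->
  is_derive t (1 : R) (fun s => coord (g s) i) (dcoord (g t) v i).
Proof.
move=> [dx dy [l gl dl] dw].
have glt : (g t).1.2 = to_circle (l t) by exact: nbhs_singleton gl.
have hE x : Defs.harmonic 1 (to_circle x) = cos x +i* sin x.
  by rewrite harmonic_to_circle mul1r.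
have gE : \forall s \near t, Defs.harmonic 1 (g s).1.2 = cos (l s) +i* sin (l s).
  by near=> s; rewrite -hE; congr (Defs.harmonic 1 _); near: s.
rewrite /dcoord glt hE; case: i => [[|[|[|[|[|//]]]]] ?] //=.
- apply: (@near_eq_is_derive _ _ _ (cos \o l)).
    by near=> s; rewrite -[RHS]/(complex.Re (Defs.harmonic 1 (g s).1.2)) (near gE s).
  by apply: is_derive_eq; rewrite mulNr mulNr mulrC.
- apply: (@near_eq_is_derive _ _ _ (sin \o l)).
    by near=> s; rewrite -[RHS]/(complex.Im (Defs.harmonic 1 (g s).1.2)) (near gE s).
  by apply: is_derive_eq; rewrite mulrC.
Unshelve. all: by end_near. Qed.

(** Makes every monomial a polynomial in the coordinates: negative frequencies become powers of the
    conjugate. *)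
Lemma harmonicE (k : int) (p : circle R) :
  Defs.harmonic k p = match k with
                      | Posz n => Defs.harmonic 1 p ^+ n
                      | Negz n => conjc (Defs.harmonic 1 p) ^+ n.+1
                      end.
Proof.
rewrite /Defs.harmonic mul1r; case: k => n; first by rewrite expi_natmul.
by rewrite NegzE -expiN -expi_natmul mulrNz mulNr mulrN.
Qed.

Section pair.
Variables (s0 : R) (d : R -> R) (g1 g2 : R -> phase R).
Hypothesis lip_coord :
  forall i, lip_pair s0 d (fun s => coord (g1 s) i) (fun s => coord (g2 s) i).

Let lip_w : lip_pair s0 d (fun s => (g1 s).2) (fun s => (g2 s).2).
Proof. by have := lip_coord (inord 4); rewrite /coord inordK. Qed.

Let clip_z : clip_pair s0 d (fun s => (g1 s).1.1) (fun s => (g2 s).1.1).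
Proof.
by split; [have := lip_coord (inord 0)|have := lip_coord (inord 1)];
  rewrite /coord inordK.
Qed.

Let clip_harmonic1 : clip_pair s0 d (fun s => Defs.harmonic 1 (g1 s).1.2)
  (fun s => Defs.harmonic 1 (g2 s).1.2).
Proof.
by split; [have := lip_coord (inord 2)|have := lip_coord (inord 3)];
  rewrite /coord inordK.
Qed.

Lemma clip_monom al :
  clip_pair s0 d (fun s => monom al (g1 s)) (fun s => monom al (g2 s)).
Proof.
have mE u : monom al u =
    u.1.1 ^+ al.1.1.1 * conjc u.1.1 ^+ al.1.1.2 * Defs.harmonic al.1.2 u.1.2
      * u.2%:C ^+ al.2.
  by case: al u => [[[a b] k] c] [[z p] w].
under [fun s => monom al (g1 s)]eq_fun do rewrite mE.
under [fun s => monom al (g2 s)]eq_fun do rewrite mE.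
apply: clipM; last exact/clipX/clip_real.
apply: clipM; first exact: clipM (clipX _ clip_z) (clipX _ (clip_conj clip_z)).
under [fun s => Defs.harmonic _ (g1 s).1.2]eq_fun do rewrite harmonicE.
under [fun s => Defs.harmonic _ (g2 s).1.2]eq_fun do rewrite harmonicE.
by case: al.1.2 => n; apply: clipX => //; exact: clip_conj.
Qed.

Lemma clip_ft_sum P f :
  clip_pair s0 d (fun s => ft_sum P f (g1 s)) (fun s => ft_sum P f (g2 s)).
Proof.
by apply: clip_sum => al _; apply: clipM; [exact: clip_cst|exact: clip_monom].
Qed.

Lemma lip_truncated_field om Om eps f i :
  let F := truncated_field om Om eps f in
  lip_pair s0 d (fun s => dcoord (g1 s) (F (g1 s)) i)
                (fun s => dcoord (g2 s) (F (g2 s)) i).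
Proof.
pose ez (u : phase R) := om *i * u.1.1 +
   eps%:C * ft_sum (fun al => lambda_z om Om al == 0) (coef_z f) u.
pose ep u := Om + eps * complex.Re (ft_sum (fun al => lambda_r om Om al == 0) (coef_psi f) u).
pose ew u := 0 + eps * complex.Re (ft_sum (fun al => lambda_r om Om al == 0) (coef_w f) u).
have FE u : truncated_field om Om eps f u = (ez u, ep u, ew u).
  by case: u => [[z p] w].
move=> F; rewrite /F.
under [fun s => dcoord (g1 s) _ _]eq_fun do rewrite FE.
under [fun s => dcoord (g2 s) _ _]eq_fun do rewrite FE.
have lez : clip_pair s0 d (fun s => ez (g1 s)) (fun s => ez (g2 s)).
  apply: clipD; first by apply: clipM => //; exact: clip_cst.
  by apply: clipM; [exact: clip_cst | exact: clip_ft_sum].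
have lep : lip_pair s0 d (fun s => ep (g1 s)) (fun s => ep (g2 s)).
  apply: lipD; first exact: lip_cst.
  by apply: lipM; [exact: lip_cst | case: (clip_ft_sum (fun al => lambda_r om Om al == 0) (coef_psi f))].
have lew : lip_pair s0 d (fun s => ew (g1 s)) (fun s => ew (g2 s)).
  apply: lipD; first exact: lip_cst.
  by apply: lipM; [exact: lip_cst | case: (clip_ft_sum (fun al => lambda_r om Om al == 0) (coef_w f))].
case: i => [[|[|[|[|[|//]]]]] ?]; rewrite /dcoord /= //.
- by case: lez.
- by case: lez.
- by apply: lipM; [exact: lipN | case: clip_harmonic1].
- by apply: lipM => //; case: clip_harmonic1.
Qed.

End pair.

Definition dist_sq (u v : phase R) : R := \sum_(i < 5) (coord u i - coord v i) ^+ 2.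

Lemma dist_sq_eq0 u v : dist_sq u v = 0 -> u = v.
Proof.
move/eqP; rewrite psumr_eq0 => [/allP E|i _]; last exact: sqr_ge0.
apply: coord_inj => i; have := E i (mem_index_enum i).
by rewrite /= sqrf_eq0 subr_eq0 => /eqP.
Qed.

Lemma solution_unique om Om eps f (I : set R) (g1 g2 : R -> phase R) :
  let F := truncated_field om Om eps f in
  open I -> is_interval I -> I 0 -> g1 0 = g2 0 ->
  (forall s, I s -> has_velocity g1 s (F (g1 s))) ->
  (forall s, I s -> has_velocity g2 s (F (g2 s))) ->
  forall s, I s -> g1 s = g2 s.
Proof.
move=> F oI itvI I0 g0 v1 v2.
have contD i (g : R -> phase R) s : has_velocity g s (F (g s)) ->
    {for s, continuous (fun s => coord (g s) i)}.
  move=> /(has_velocity_coord i) [dg _].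
  exact/differentiable_continuous/derivable1_diffP.
pose D s := dist_sq (g1 s) (g2 s).
have D_open s0 : I s0 -> D s0 = 0 -> \forall s \near s0, D s = 0.
  move=> Is0 Ds0.
  have nI : \forall s \near s0, I s by exact: open_nbhs_nbhs.
  apply: (@local_uniqueness _ 5 (fun i s => coord (g1 s) i) (fun i s => coord (g2 s) i)
    (fun i s => dcoord (g1 s) (F (g1 s)) i) (fun i s => dcoord (g2 s) (F (g2 s)) i)) => // i.
  - by near=> s; apply/has_velocity_coord/v1; near: s.
  - by near=> s; apply/has_velocity_coord/v2; near: s.
  apply: lip_truncated_field => j; split; [exact/contD/v1|exact/contD/v2|].
  (* The constant is 1 because a single coordinate difference never exceeds the Euclidean
     distance. *)
  exists 1; near=> s; rewrite mul1r -sqrtr_sqr ler_wsqrtr // (bigD1 j) //= lerDl.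
  by apply: sumr_ge0 => k _; exact: sqr_ge0.
have contDs s0 : I s0 -> {for s0, continuous D}.
  move=> Is0; rewrite (_ : D = \sum_(i < 5)
     (fun s => (coord (g1 s) i - coord (g2 s) i) ^+ 2)); last first.
    by rewrite fct_sumE.
  elim/big_ind: _ => [|h k ch ck|i _]; first exact: cst_continuous.
    exact: continuousD.
  apply: (@continuous_comp _ _ _ (fun s => coord (g1 s) i - coord (g2 s) i) (fun x => x ^+ 2)).
    by apply: continuousB; [exact/contD/v1|exact/contD/v2].
  exact: exprn_continuous.
have oE : open (I `&` [set s | D s = 0]).
  rewrite openE => s0 [Is0 Ds0]; apply: filterI; first exact: open_nbhs_nbhs.
  exact: D_open.
(* Continuity of [D] is known only on [I], so closedness of the zero set relative to [I] is obtained
   from this open complement. *)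
have oN : open (I `&` [set s | D s != 0]).
  rewrite openE => s0 [Is0 Ds0]; apply: filterI; first exact: open_nbhs_nbhs.
  exact: cvgr_neq0 (contDs _ Is0) Ds0.
have /connected_intervalP cI := itvI.
have EI : I `&` [set s | D s = 0] = I.
  apply: cI.
  - exists 0; split=> //=; rewrite /D g0 /dist_sq big1 // => i _.
    by rewrite subrr expr0n.
  - by exists (I `&` [set s | D s = 0]) => //; rewrite setIA setIid.
  - exists (~` (I `&` [set s | D s != 0])); first exact: open_closedC.
    apply/seteqP; split=> s /= [Is].
      by move=> Ds; split=> // -[_]; rewrite Ds eqxx.
    by move=> nDs; split=> //; apply: contra_notP nDs => /eqP.
by move=> s; rewrite -EI => -[_ /dist_sq_eq0].
Unshelve. all: by end_near. Qed.

End coordinates.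

(** * The flow of the truncated field and its relative equilibria *)

Section relative_equilibria.
Variables (R : realType) (om Om eps : R) (f : ft_coefs R).

Let F := truncated_field om Om eps f.

(** The two solutions may live on different intervals; the intersection is again an open interval
    containing [0] and [t], and uniqueness applies there. *)
Lemma flows_to_unique t u v v' : flows_to F t u v -> flows_to F t u v' -> v = v'.
Proof.
move=> [I [g [[oI iI I0 It] [g0 gt gv]]]] [J [h [[oJ iJ J0 Jt] [h0 ht hv]]]].
rewrite -gt -ht.
apply: (@solution_unique _ om Om eps f (I `&` J)) => //.
- exact: openI.
- by move=> x y [Ix Jx] [Iy Jy] z xyz; split; [exact: iI xyz|exact: iJ xyz].
- by rewrite g0 h0.
- by move=> s [/gv].
- by move=> s [_ /hv].
Qed.

(** Uniqueness identifies the point picked by choice in [flow] with any endpoint reached by a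
    solution. *)
Lemma flowP t u v : flow F t u = Some v <-> flows_to F t u v.
Proof.
rewrite /flow; case: pselect => [ex|nex]; split=> //.
- by move=> [<-]; exact: projT2 (cid ex).
- by move=> uv; congr Some; exact: flows_to_unique (projT2 (cid ex)) uv.
- by move=> uv; case: nex; exists v.
Qed.

(* The right-hand side is [xi] times [L0 om Om u]. *)
Definition balanced (xi : R) (u : phase R) : Prop :=
  F u = ((xi * om) *i * u.1.1, xi * Om, 0).

Lemma rotate0 u : rotate om Om 0 u = u.
Proof.
case: u => [[z p] w]; rewrite /rotate !mulr0 expi0 mul1r.
by rewrite (_ : to_circle 0 = 0) ?addr0 // /to_circle raddf0.
Qed.

Lemma rotateD a b u : rotate om Om a (rotate om Om b u) = rotate om Om (a + b) u.
Proof.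
case: u => [[z p] w]; rewrite /rotate mulrA -expiD -mulrDr -addrA -to_circleD.
by rewrite -mulrDr [b + a]addrC.
Qed.

Lemma balanced_rotate xi theta u :
  balanced xi u -> balanced xi (rotate om Om theta u).
Proof.
rewrite /balanced /F truncated_field_equivariant => ->.
by case: u => [[z p] w] /=; rewrite mulrCA.
Qed.

Lemma has_velocity_rotate xi t u :
  has_velocity (fun s => rotate om Om (xi * s) u) t
    ((xi * om) *i * (rotate om Om (xi * t) u).1.1, xi * Om, 0).
Proof.
case: u => [[[x y] p] w]; rewrite /rotate; split=> /=.
- by apply: is_derive_eq; rewrite /GRing.scale /=; ring.
- by apply: is_derive_eq; rewrite /GRing.scale /=; ring.
(* Along a rotation orbit the angle has this global affine lift. *)
- exists (fun s => circle_repr p + Om * (xi * s)).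
    by near=> s; rewrite to_circleD circle_reprK.
  by apply: is_derive_eq; rewrite /GRing.scale /=; ring.
- exact: is_derive_cst.
Unshelve. all: by end_near. Qed.

Lemma balanced_relative_equilibrium xi u :
  balanced xi u -> relative_equilibrium om Om F u xi.
Proof.
move=> bu t; apply/flowP; exists setT, (fun s => rotate om Om (xi * s) u).
split; first by split => //; exact: openT.
split; [by rewrite mulr0 rotate0|by []|move=> s _].
by rewrite (balanced_rotate (xi * s) bu); exact: has_velocity_rotate.
Qed.

Lemma relative_equilibrium_balanced xi u :
  relative_equilibrium om Om F u xi -> balanced xi u.
Proof.
move=> eq_u.
have /flowP[I [g [[oI iI I0 I1] [g0 g1 gv]]]] := eq_u 1.
(* The hypothesis speaks of each time separately, possibly through different solutions; uniqueness
   makes the single curve [g] follow the orbit on all of [[0, 1]]. *)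
have gE s : 0 <= s <= 1 -> g s = rotate om Om (xi * s) u.
  move=> s01; apply: (@flows_to_unique s u); last exact/flowP.
  by exists I, g; split; split => //; exact: iI s01.
(* An interior time is chosen so that [g] and the orbit agree on a full neighbourhood and have the
   same two-sided derivative. *)
have half01 : 0 <= (2^-1 : R) <= 1 by lra.
have Ihalf : I 2^-1 by exact: iI half01.
set v := rotate om Om (xi * 2^-1) u.
have gv2 : g 2^-1 = v by rewrite gE.
have bv : balanced xi v.
  apply: (@dcoord_inj _ v) => i.
  have dg := has_velocity_coord i (gv _ Ihalf).
  have dr := has_velocity_coord i (has_velocity_rotate xi 2^-1 u).
  rewrite -/v gv2 in dg dr.
  have {}dg : is_derive (2^-1 : R) (1 : R)
      (fun s => coord (rotate om Om (xi * s) u) i) (dcoord v (F v) i).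
    apply: near_eq_is_derive dg; near=> s; rewrite gE //.
    by apply/andP; split; apply: ltW; near: s; [apply: lt_nbhsr|apply: lt_nbhsl]; lra.
  by have [_ <-] := dg; have [_ <-] := dr.
rewrite -(rotate0 u) -(addNr (xi * 2^-1)) -rotateD; exact: balanced_rotate.
Unshelve. all: by end_near. Qed.

End relative_equilibria.

(** * The conditions (a) and (b) on the cross-section *)

Theorem theorem6p5 (R : realType) (om Om eps : R) (F : phase R -> tangent R)
    (f : ft_coefs R)
    (om_gt0 : 0 < om) (Om_neq0 : Om != 0)
    (om_Om_rat : exists q : rat, om / Om = ratr q)
    (eps_gt0 : 0 < eps)
    (F_expansion : ft_expansion F f) :
  let Fbar_z u := (resonant_field om Om f u).1.1 in
  let Fbar_psi u := (resonant_field om Om f u).1.2 in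
  let Fbar_w u := (resonant_field om Om f u).2 in
  let calF := truncated_field om Om eps f in
  (forall (u uS : phase R) (xi theta x : R) (psi : circle R) (w : R),
    relative_equilibrium om Om calF u xi ->
    u.1.1 != 0 ->
    uS = rotate om Om theta u ->
    cross_section uS ->
    uS = (x%:C, psi, w) ->
    (xi = 1 + eps / Om * Fbar_psi uS /\
     xi = 1 + eps / (om * x) * complex.Im (Fbar_z uS)) /\
    [/\ complex.Re (Fbar_z uS) = 0,
        Fbar_w uS = 0 &
        complex.Im (Fbar_z uS) / x = om / Om * Fbar_psi uS]) /\
  (forall (uS : phase R) (x : R) (psi : circle R) (w : R),
    cross_section uS ->
    uS = (x%:C, psi, w) ->
    0 < x ->
    [/\ complex.Re (Fbar_z uS) = 0,
        Fbar_w uS = 0 &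
        complex.Im (Fbar_z uS) / x = om / Om * Fbar_psi uS] ->
    exists xi : R,
      [/\ xi = 1 + eps / Om * Fbar_psi uS /\
          xi = 1 + eps / (om * x) * complex.Im (Fbar_z uS),
          relative_equilibrium om Om calF uS xi &
          forall u0 : phase R, orbit_of om Om uS u0 ->
            relative_equilibrium om Om calF u0 xi]).
Proof.
move=> Fz Fp Fw calF.
(* With [z = x] real, the rotation part [i om x] is purely imaginary, so the real part of the
   [z]-equation contains only the perturbation. *)
have balE (x xi : R) psi w : 0 < x -> let uS := (x%:C, psi, w) in
    balanced om Om eps f xi uS <->
    [/\ eps * complex.Re (Fz uS) = 0, om * x + eps * complex.Im (Fz uS) = xi * om * x,
        Om + eps * Fp uS = xi * Om & eps * Fw uS = 0].
  move=> x0 uS; rewrite /balanced /truncated_field /uS /L0.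
  rewrite /Fz /Fp /Fw; case: (resonant_field om Om f _) => [[[a b] p] q] /=.
  split=> [[re im ps qw]|[re im ps qw]]; first by split; lra.
  by congr (_ +i* _, _, _); lra.
have eps0 : eps != 0 by rewrite gt_eqF.
have om0 : om != 0 by rewrite gt_eqF.
split.
  move=> u uS xi theta x psi w eq_u _ uSE csS uSx.
  have x0 : 0 < x by move: csS => [_]; rewrite uSx.
  have xn0 : x != 0 by rewrite gt_eqF.
  have : balanced om Om eps f xi uS.
    rewrite uSE; apply: balanced_rotate; exact: relative_equilibrium_balanced.
  rewrite uSx => /balE -/(_ x0)[re im ps qw].
  have xi1 : xi = 1 + eps / Om * Fp (x%:C, psi, w).
    by apply: (mulIf Om_neq0); rewrite -ps; field.
  have xi2 : xi = 1 + eps / (om * x) * complex.Im (Fz (x%:C, psi, w)).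
    apply: (mulIf (mulf_neq0 om0 xn0)); rewrite mulrA -im; field.
    by rewrite om0 xn0.
  split=> //; split; [by apply: (mulfI eps0); rewrite mulr0|
    by apply: (mulfI eps0); rewrite mulr0|].
  (* After scaling by [eps / om], both sides equal [xi - 1] by the two formulas for the group
     velocity. *)
  apply: (mulfI eps0); apply: (mulIf (invr_neq0 om0)).
  transitivity (xi - 1).
    by rewrite xi2; field; rewrite om0 xn0.
  by rewrite xi1; field; rewrite om0 Om_neq0.
move=> uS x psi w _ uSx x0; rewrite uSx => -[re qw im].
have xn0 : x != 0 by rewrite gt_eqF.
(* The velocity is read off from the angular equation; the third condition of (b) then makes the
   imaginary part of the [z]-equation hold with the same value. *)
pose xi := 1 + eps / Om * Fp (x%:C, psi, w).
have imE : complex.Im (Fz (x%:C, psi, w)) = om / Om * Fp (x%:C, psi, w) * x.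
  by rewrite -im divfK.
have bal : balanced om Om eps f xi (x%:C, psi, w).
  apply/balE => //; split; rewrite ?re ?qw ?mulr0 // ?imE /xi; by field.
exists xi; split.
- by split=> //; rewrite imE /xi; field; rewrite om0 Om_neq0 xn0.
- exact: balanced_relative_equilibrium.
- move=> _ [theta _ <-].
  exact/balanced_relative_equilibrium/balanced_rotate.
Qed.
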